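(* For variables $a$, $z$ and $q$ (say as formal power series in $q$, or for $|q|<1$), we have \[ \sum_{n\geq0} \frac{(za;q)_n\,(z q^{n+1};q)_\infty}{(q;q)_n}\, z^n q^{\frac{n(n+1)}{2}} = \sum_{n\geq0} \frac{(-za;q)_n\,(-zq^{n+1};q)_\infty}{(q;q)_n}\,(-z)^n q^{\frac{n(n+1)}{2}}. \]
   Context: The $q$-Pochhammer symbol is $(a;q)_n=\prod_{i=0}^{n-1}(1-aq^i)$ for $n\in\mathbb{Z}_{\ge 0}\cup\{\infty\}$. *)

(* Defs.v *)
From HB Require Import structures.
From mathcomp Require Import all_boot all_order all_algebra.
From mathcomp Require Import complex.
From mathcomp Require Import all_classical all_reals all_analysis.

Set Implicit Arguments.
Unset Strict Implicit.
Unset Printing Implicit Defensive.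

Import Order.TTheory GRing.Theory Num.Theory.
Import numFieldNormedType.Exports.

Local Open Scope classical_set_scope.
Local Open Scope ring_scope.
Local Open Scope complex_scope.

Definition qpoch (A : pzRingType) (x q : A) (n : nat) : A :=
  \prod_(i < n) (1 - x * q ^+ i).

(* (x; q)_oo, for A a ring with a topology; only meaningful together with
   [cvgn (qpoch x q)], since [lim] takes an arbitrary value otherwise. *)
Notation qpoch_oo x q := (limn (qpoch x q)).

(* MathComp-Analysis puts the metric topology of a numFieldType K on K^o; this
   makes it available on the complex numbers R[i] themselves. *)
HB.instance Definition _ (R : realType) := NormedModule.copy R[i] (R[i]^o).

(* A record rather than an alias of [nat -> R], so that the pointwise ring
   structure and the product topology of [nat -> R] are not inferred. *)
Record fps (R : Type) := Fps { fcoef : nat -> R }.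

HB.instance Definition _ (R : Type) := gen_eqMixin (fps R).
HB.instance Definition _ (R : Type) := gen_choiceMixin (fps R).

Lemma fpsP (R : Type) (f g : fps R) : fcoef f =1 fcoef g -> f = g.
Proof. by case: f g => [f] [g] /= /funext ->. Qed.

Section FpsRing.
Variable R : comNzRingType.
Implicit Types f g h : fps R.

Definition fpsC (c : R) : fps R := Fps (fun n => if n is 0%N then c else 0).
Definition fpsX : fps R := Fps (fun n => (n == 1%N)%:R).

Definition fps_add f g := Fps (fun n => fcoef f n + fcoef g n).
Definition fps_opp f := Fps (fun n => - fcoef f n).
Definition fps_mul f g :=
  Fps (fun n => \sum_(i < n.+1) fcoef f i * fcoef g (n - i)%N).

Fact fps_addA : associative fps_add.
Proof. by move=> f g h; apply: fpsP => n /=; rewrite addrA. Qed.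
Fact fps_addC : commutative fps_add.
Proof. by move=> f g; apply: fpsP => n /=; rewrite addrC. Qed.
Fact fps_add0 : left_id (fpsC 0) fps_add.
Proof. by move=> f; apply: fpsP => -[|n] /=; rewrite add0r. Qed.
Fact fps_addN : left_inverse (fpsC 0) fps_opp fps_add.
Proof. by move=> f; apply: fpsP => -[|n] /=; rewrite addNr. Qed.

HB.instance Definition _ :=
  GRing.isZmodule.Build (fps R) fps_addA fps_addC fps_add0 fps_addN.

Let trunc N f : {poly R} := \poly_(i < N) fcoef f i.

Let coef_trunc N f n : (n < N)%N -> (trunc N f)`_n = fcoef f n.
Proof. by move=> nN; rewrite coef_poly nN. Qed.

Let fps_mul_trunc N f g n : (n < N)%N ->
  fcoef (fps_mul f g) n = (trunc N f * trunc N g)`_n.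
Proof.
move=> nN; rewrite coefM; apply: eq_bigr => i _; rewrite !coef_trunc //.
  by rewrite (leq_ltn_trans (leq_subr _ _)).
by rewrite (leq_ltn_trans _ nN) // -ltnS.
Qed.

Let fps_mul_truncl N f g h n : (n < N)%N ->
  fcoef (fps_mul (fps_mul f g) h) n = (trunc N f * trunc N g * trunc N h)`_n.
Proof.
move=> nN; rewrite coefM; apply: eq_bigr => i _.
rewrite (@fps_mul_trunc N) ?coef_trunc //.
  by rewrite (leq_ltn_trans (leq_subr _ _)).
by rewrite (leq_ltn_trans _ nN) // -ltnS.
Qed.

Fact fps_mulC : commutative fps_mul.
Proof.
by move=> f g; apply: fpsP => n; rewrite !(@fps_mul_trunc n.+1) // mulrC.
Qed.
Fact fps_mulA : associative fps_mul.
Proof.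
move=> f g h; apply: fpsP => n.
by rewrite fps_mulC !(@fps_mul_truncl n.+1) // mulrC mulrA.
Qed.
Fact fps_mul1 : left_id (fpsC 1) fps_mul.
Proof.
move=> f; apply: fpsP => n /=.
by rewrite big_ord_recl /= mul1r subn0 big1 ?addr0 // => i _; rewrite mul0r.
Qed.
Fact fps_mulDl : left_distributive fps_mul fps_add.
Proof.
move=> f g h; apply: fpsP => n /=; rewrite -big_split /=.
by apply: eq_bigr => i _; rewrite mulrDl.
Qed.
Fact fps_1neq0 : fpsC 1 != 0.
Proof. by apply/eqP => /(congr1 (fun f => fcoef f 0)) /eqP; rewrite oner_eq0. Qed.

HB.instance Definition _ := GRing.Zmodule_isComNzRing.Build (fps R)
  fps_mulA fps_mulC fps_mul1 fps_mulDl fps_1neq0.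

Definition fps_unit : {pred fps R} := fun f => `[< exists g, g * f = 1 >].
Definition fps_inv f : fps R :=
  if pselect (exists g, g * f = 1) is left gf then projT1 (cid gf) else f.

Fact fps_mulVf : {in fps_unit, left_inverse 1 fps_inv *%R}.
Proof.
move=> f /asboolP uf; rewrite /fps_inv.
by case: pselect => // gf; case: (cid gf).
Qed.
Fact fps_unitPl f g : g * f = 1 -> fps_unit f.
Proof. by move=> gf; apply/asboolP; exists g. Qed.
Fact fps_inv_out : {in [predC fps_unit], fps_inv =1 id}.
Proof.
by move=> f /asboolPn nuf; rewrite /fps_inv; case: pselect.
Qed.

HB.instance Definition _ := GRing.ComNzRing_hasMulInverse.Build (fps R)
  fps_mulVf fps_unitPl fps_inv_out.

HB.instance Definition _ := isPointed.Build (fps R) 0.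

(* The X-adic topology: the sets f + X^N R[[X]] are a neighborhood basis of f *)
Definition fps_nbhs f : set_system (fps R) :=
  filter_from setT
    (fun N => [set g | forall k, (k < N)%N -> fcoef g k = fcoef f k]).

HB.instance Definition _ := hasNbhs.Build (fps R) fps_nbhs.

Fact fps_nbhs_filter f : ProperFilter (nbhs f).
Proof.
apply: filter_from_proper; last by move=> N _; exists f.
apply: filter_from_filter; first by exists 0%N.
move=> M N _ _; exists (maxn M N) => // g fg.
by split=> k kl; apply: fg; rewrite leq_max kl ?orbT.
Qed.
Fact fps_nbhs_singleton f (A : set (fps R)) : nbhs f A -> A f.
Proof. by case=> N _; apply. Qed.
Fact fps_nbhs_nbhs f (A : set (fps R)) : nbhs f A -> nbhs f (nbhs^~ A).
Proof.
case=> N _ NA; exists N => // g fg; exists N => // h gh.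
by apply: NA => k kN; rewrite gh // fg.
Qed.

HB.instance Definition _ := Nbhs_isNbhsTopological.Build (fps R)
  fps_nbhs_filter fps_nbhs_singleton fps_nbhs_nbhs.

Lemma fps_cvgP (u : nat -> fps R) (l : fps R) :
  u @ \oo --> l <-> forall k, \forall n \near \oo, fcoef (u n) k = fcoef l k.
Proof.
split=> [ul k|ul A [N _ NA]].
  have : nbhs l [set g | fcoef g k = fcoef l k].
    by exists k.+1 => // g; apply.
  exact: ul.
have : \forall n \near \oo, forall k, (k < N)%N -> fcoef (u n) k = fcoef l k.
  elim: N {NA} => [|N IH]; first exact: nearW.
  near=> n => k; rewrite ltnS leq_eqVlt => /predU1P[->|].
    by near: n; exact: ul.
  by move: k; near: n.
by apply: filterS => n /NA.
Unshelve. all: by end_near. Qed.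

End FpsRing.

(* Main.v *)
(* Dividing by (q; q)_n, write e_n = 1/(q; q)_n. Replace (z q^(n+1); q)_oo by
   (z q^(n+1); q)_(M-n) e_(M-n) and sum over n <= M. Expanding both Pochhammer
   symbols by the finite q-binomial theorem gives the sum over k + m + j <= M of
     e_k e_m e_j e_(M-k-m-j) (-a)^k q^(C(k,2) + C(k+m+j+1,2)) z^(2k+m) (-z)^j,
   where z -> -z amounts to exchanging m and j: the finite sum is even in z.
   Multiplying by (q; q)_M and letting M -> oo (Tannery) gives the identity in
   any commutative ring complete for a submultiplicative real-valued norm with
   |q| < 1. Both C and R[[q]], with the norm 2^(-ord), are such rings. *)

Require Import Defs.
From mathcomp Require Import all_boot all_order all_algebra.
From mathcomp Require Import complex.
From mathcomp Require Import all_classical all_reals all_analysis.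
From mathcomp Require Import ring Rstruct.

Set Implicit Arguments.
Unset Strict Implicit.
Unset Printing Implicit Defensive.

Import Order.TTheory GRing.Theory Num.Theory.
Import numFieldNormedType.Exports.

Local Open Scope classical_set_scope.
Local Open Scope ring_scope.
Local Open Scope complex_scope.

(** * Reindexing of finite triangular sums *)

Lemma sum_triangle (V : nmodType) (F : nat -> nat -> V) (M : nat) :
  \sum_(n < M.+1) \sum_(k < n.+1) F k (n - k)%N =
  \sum_(k < M.+1) \sum_(m < (M - k).+1) F k m.
Proof.
elim: M => [|M IH]; first by rewrite !big_ord_recr !big_ord0.
rewrite big_ord_recr IH [RHS]big_ord_recr /= subnn big_ord1.
rewrite [X in _ + X]big_ord_recr /= subnn addrA; congr (_ + _).
rewrite -big_split; apply: eq_bigr => k _ /=.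
by rewrite subSn ?leq_ord // [RHS]big_ord_recr.
Qed.

(** On each antidiagonal, exchanging the two indices amounts to reversing the inner sum. *)
Lemma sum_triangleC (V : nmodType) (F : nat -> nat -> V) (M : nat) :
  \sum_(k < M.+1) \sum_(m < (M - k).+1) F k m =
  \sum_(k < M.+1) \sum_(m < (M - k).+1) F m k.
Proof.
rewrite -sum_triangle -(sum_triangle (fun k m => F m k)).
apply: eq_bigr => n _.
rewrite (reindex_inj rev_ord_inj); apply: eq_bigr => k _ /=.
by rewrite subSS subKn // leq_ord.
Qed.

Lemma qpochS (A : pzRingType) (x q : A) n :
  qpoch x q n.+1 = qpoch x q n * (1 - x * q ^+ n).
Proof. by rewrite /qpoch big_ord_recr. Qed.

(** * The finite identity, exact for each [M] *)

Section FiniteIdentity.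
Variables (A : comUnitRingType) (q : A).
Hypothesis unitq : forall n, 1 - q ^+ n.+1 \is a GRing.unit.

Let e n := (qpoch q q n)^-1.

Let unit_qpoch n : qpoch q q n \is a GRing.unit.
Proof. by apply: rpred_prod => i _; rewrite -exprS. Qed.

Let eS n : e n.+1 * (1 - q ^+ n.+1) = e n.
Proof. by rewrite /e qpochS -exprS invrM // mulrAC mulVr // mul1r. Qed.

Let e0 : e 0 = 1. Proof. by rewrite /e /qpoch big_ord0 invr1. Qed.

(* The finite q-binomial theorem, divided by (q; q)_n. *)
Lemma qbinomial_theorem (x : A) n : qpoch x q n / qpoch q q n =
  \sum_(k < n.+1) e k * e (n - k) * ((- x) ^+ k * q ^+ 'C(k, 2)).
Proof.
elim: n => [|n IH].
  by rewrite big_ord1 bin0n !expr0 e0 /qpoch !big_ord0 invr1 !mulr1.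
apply: (mulIr (unitq n)).
rewrite -mulrA eS qpochS mulrAC {}IH mulr_suml.
(* Splits 1 - q^(n+1) as (1 - q^(n+1-k)) + q^(n+1-k) (1 - q^k). These factors lower the index of
   e(n+1-k) and of e(k) respectively. The first sum loses k = n+1, the second k = 0, and shifting
   the second aligns them. *)
transitivity (\sum_(k < n.+2) (e k * (e (n.+1 - k) * (1 - q ^+ (n.+1 - k)))
    * ((- x) ^+ k * q ^+ 'C(k, 2))) + \sum_(k < n.+2)
  (e k * (1 - q ^+ k) * (q ^+ (n.+1 - k) * e (n.+1 - k))
    * ((- x) ^+ k * q ^+ 'C(k, 2)))); last first.
  rewrite mulr_suml -big_split /=; apply: eq_bigr => k _.
  have -> : q ^+ n.+1 = q ^+ (n.+1 - k) * q ^+ k.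
    by rewrite -exprD subnK // leq_ord.
  by ring.
rewrite [X in _ = X + _]big_ord_recr /= subnn expr0 subrr !mulr0 mul0r addr0.
rewrite [X in _ = _ + X]big_ord_recl /= expr0 subrr mulr0 !mul0r add0r.
rewrite -big_split; apply: eq_bigr => k _ /=.
rewrite /bump /= add1n subSS subSn ?leq_ord // eS.
rewrite eS binS bin1 addnC !exprD !exprS.
have {1}-> : q ^+ n = q ^+ (n - k) * q ^+ k by rewrite -exprD subnK // leq_ord.
by ring.
Qed.

(** Cutting the second symbol at order [M - n] makes the expansion range over k + m + j <= M, which
    is symmetric in m and j. *)
Definition finite_sum (a z : A) (M : nat) : A :=
  \sum_(n < M.+1) qpoch (z * a) q n / qpoch q q n
    * (qpoch (z * q ^+ n.+1) q (M - n) / qpoch q q (M - n))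
    * z ^+ n * q ^+ 'C(n.+1, 2).

(** Here k and j index the expansions of the two Pochhammer symbols and m = n - k. Apart from the
    powers of z and - z, m and j enter symmetrically. *)
Let term (a z : A) M k m j : A := e k * e m * e j * e (M - (k + m) - j)
  * (- a) ^+ k * q ^+ 'C(k, 2) * q ^+ 'C((k + m + j).+1, 2)
  * (z ^+ k.*2 * z ^+ m * (- z) ^+ j).

Let finite_sum_expand (a z : A) M : finite_sum a z M =
  \sum_(k < M.+1) \sum_(m < (M - k).+1) \sum_(j < (M - k - m).+1)
     term a z M k m j.
Proof.
pose G k m := \sum_(j < (M - (k + m)).+1) term a z M k m j.
transitivity (\sum_(n < M.+1) \sum_(k < n.+1) G k (n - k)%N); last first.
  rewrite sum_triangle; apply: eq_bigr => k _; apply: eq_bigr => m _.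
  by rewrite /G subnDA.
apply: eq_bigr => n _; rewrite !qbinomial_theorem.
rewrite -!mulrA mulr_suml; apply: eq_bigr => k _; rewrite {}/G.
have -> : (k + (n - k) = n)%N by rewrite subnKC // leq_ord.
rewrite mulr_suml mulr_sumr; apply: eq_bigr => j _.
rewrite /term (_ : (k + (n - k) = n)%N); last by rewrite subnKC // leq_ord.
(* The cross term (n+1) j is the contribution of the argument z q^(n+1) of the second symbol. *)
have -> : 'C((n + j).+1, 2) = ('C(n.+1, 2) + n.+1 * j + 'C(j, 2))%N.
  rewrite -addSn; elim: (val j) => [|i IHi]; first by rewrite muln0 !addn0.
  by rewrite addnS binS bin1 IHi (binS i) bin1 mulnS; ring.
have zn : z ^+ n = z ^+ (n - k) * z ^+ k by rewrite -exprD subnK // leq_ord.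
rewrite zn !(exprD q ('C(_, 2) + _)) (exprD q 'C(_, 2)) exprM -addnn exprD.
by rewrite -(mulrN z) -(mulNr z (q ^+ _)) !(exprMn k) !(exprMn j); ring.
Qed.

(* Replacing z by - z exchanges the two summation indices m and j. *)
Lemma finite_sumN (a z : A) M : finite_sum a (- z) M = finite_sum a z M.
Proof.
rewrite !finite_sum_expand; apply: eq_bigr => k _.
rewrite (sum_triangleC (fun m j => term a (- z) M k m j)).
apply: eq_bigr => m _; apply: eq_bigr => j _; rewrite /term.
have -> : (M - (k + j) - m = M - (k + m) - j)%N 
  by rewrite -(subnDA (k + j)) -(subnDA (k + m)) addnAC.
have -> : (k + j + m = k + m + j)%N by rewrite addnAC.
by rewrite opprK -mul2n !(exprM _ 2) sqrrN; ring.
Qed.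

End FiniteIdentity.

(** * Geometric domination for real sequences *)

Section RealSequences.
Variable R : realType.
Implicit Types (f g : nat -> R) (r K : R).

Lemma squeeze0 f g : (forall n, 0 <= f n <= g n) ->
  g @ \oo --> (0 : R) -> f @ \oo --> (0 : R).
Proof. by move=> fg; apply: squeeze_cvgr (@cvg_cst _ _ _ _ _); apply: nearW. Qed.

Lemma sum_geometric_le r n : 0 <= r < 1 -> \sum_(i < n) r ^+ i <= (1 - r)^-1.
Proof.
move=> /andP[r0 r1]; have r1' : 0 < 1 - r by rewrite subr_gt0.
rewrite -[leRHS]mul1r ler_pdivlMr // mulrC.
have -> : (1 - r) * \sum_(i < n) r ^+ i = 1 - r ^+ n.
  by rewrite -opprB mulNr -subrX1 opprB.
by rewrite lerBlDr lerDl exprn_ge0.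
Qed.

(** By 1 + t <= exp t the product is at most the exponential of a geometric sum, uniformly in
    [n]. *)
Lemma prod_geometric_le r K n : 0 <= r < 1 -> 0 <= K ->
  \prod_(i < n) (1 + K * r ^+ i) <= expR (K / (1 - r)).
Proof.
move=> r01 K0; have /andP[r0 _] := r01.
apply: (@le_trans _ _ (\prod_(i < n) expR (K * r ^+ i))).
  apply: ler_prod => i _; rewrite expR_ge1Dx andbT.
  by rewrite addr_ge0 // mulr_ge0 // exprn_ge0.
rewrite -expR_sum ler_expR -mulr_sumr ler_wpM2l //.
exact: sum_geometric_le.
Qed.

(** Tannery's theorem with zero limits and a range growing with M: domination makes the tail beyond
    a fixed m small uniformly in M, and the head is a finite sum of null sequences. *)
Lemma tannery0 (h : nat -> nat -> R) r K : 0 <= r < 1 ->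
  (forall M n, (n <= M)%N -> 0 <= h M n <= K * r ^+ n) ->
  (forall n, (h ^~ n) @ \oo --> (0 : R)) ->
  (fun M => \sum_(n < M.+1) h M n) @ \oo --> (0 : R).
Proof.
move=> r01 hK h0; have /andP[r0 r1] := r01.
have K0 : 0 <= K.
  have /andP[h00 hK0] := hK 0 0 (leqnn _).
  by have := le_trans h00 hK0; rewrite expr0 mulr1.
have sum0 m : (fun M => \sum_(n < m) h M n) @ \oo --> (0 : R).
  elim: m => [|m IH].
    by under eq_fun do rewrite big_ord0; exact: cvg_cst.
  have : (fun M => \sum_(n < m) h M n + h M m) @ \oo --> (0 + 0 : R).
    exact: cvgD.
  by rewrite addr0; under [in X in _ -> X]eq_fun do rewrite big_ord_recr.
apply/cvgr0Pnorm_lt => eps eps0.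
have [m] : exists m, K * (1 - r)^-1 * r ^+ m < eps / 2.
  have := @cvg_geometric R (K * (1 - r)^-1) r.
  rewrite ger0_norm // => /(_ r1)/cvgr0Pnorm_lt/(_ (eps / 2)).
  case; first by rewrite divr_gt0.
  move=> m _ /(_ m (leqnn _)) /= lem; exists m.
  exact: le_lt_trans (ler_norm _) lem.
move=> tailm; near=> M.
have mM : (m <= M)%N by near: M; exact: nbhs_infty_ge.
rewrite ger0_norm; last first.
  by apply: sumr_ge0 => n _; have /andP[] := hK M n (leq_ord n).
rewrite -(big_mkord predT (h M)) (@big_cat_nat _ _ _ m 0) //=; last exact: leqW.
rewrite [ltRHS]splitr; apply: ltr_leD.
  rewrite big_mkord; apply: le_lt_trans (ler_norm _) _.
  by near: M; move/cvgr0Pnorm_lt: (sum0 m); apply; rewrite divr_gt0.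
apply: le_trans (ltW tailm); rewrite -mulrA [(1 - r)^-1 * _]mulrC mulrA.
rewrite -{1}(add0n m) big_addn big_mkord.
apply: (@le_trans _ _ (\sum_(i < M.+1 - m) K * r ^+ m * r ^+ i)).
  apply: ler_sum => i _; rewrite -mulrA -exprD addnC.
  have miM : (m + i <= M)%N by have := ltn_ord i; rewrite ltn_subRL ltnS.
  by have /andP[] := hK M _ miM.
rewrite -mulr_sumr ler_wpM2l ?mulr_ge0 ?exprn_ge0 //.
exact: sum_geometric_le.
Unshelve. all: by end_near. Qed.

Lemma cvg_geometric_increments (u : nat -> R) r K : 0 <= r < 1 ->
  (forall n, `|u n.+1 - u n| <= K * r ^+ n) -> cvgn u.
Proof.
move=> /andP[r0 r1] uK.
have cu : cvgn (series (telescope u)).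
  have g0 n : 0 <= geometric K r n by apply: le_trans (normr_ge0 _) (uK n).
  apply: normed_cvg; apply: series_le_cvg g0 uK _ => [n|]; first exact: normr_ge0.
  by apply: is_cvg_geometric_series; rewrite ger0_norm.
rewrite (_ : u = fun n => u 0 + series (telescope u) n).
  by apply: is_cvgD => //; exact: is_cvg_cst.
by apply/funext => n; rewrite -eq_sum_telescope.
Qed.

End RealSequences.

(** Convergence is expressed by the norm alone, so that the general argument needs no topology on
    [A]; each instance compares it with its own topology. *)
Definition norm_cvg (R : realType) (A : zmodType) (N : A -> R)
  (u : nat -> A) (l : A) := (fun n => N (u n - l)) @ \oo --> (0 : R).

(** * The identity in a complete normed commutative ring *)

Section CompleteNormedRing.
Variables (R : realType) (A : comUnitRingType) (N : A -> R).
Hypothesis N0 : N 0 = 0.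
Hypothesis N1 : N 1 <= 1.
Hypothesis N_eq0 : forall x, N x = 0 -> x = 0.
Hypothesis NN : forall x, N (- x) = N x.
Hypothesis ND : forall x y, N (x + y) <= N x + N y.
Hypothesis NM : forall x y, N (x * y) <= N x * N y.
(** Completeness in the form used for all limits below: geometric series, the products (x; q)_n and
    the partial sums all have geometrically bounded increments. *)
Hypothesis N_complete : forall (u : nat -> A) (r K : R), 0 <= r < 1 ->
  (forall n, N (u n.+1 - u n) <= K * r ^+ n) -> exists l, norm_cvg N u l.

Local Notation ncvg := (norm_cvg N).

(** 0 = N (x - x) <= N x + N (- x) = 2 N x. *)
Let N_ge0 x : 0 <= N x.
Proof.
have : 0 <= N x + N x by rewrite -[X in _ + X]NN -N0 -(subrr x).
by rewrite -mulr2n pmulrn_lge0.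
Qed.
#[local] Hint Resolve N_ge0 : core.

Let NX x n : N (x ^+ n) <= N x ^+ n.
Proof.
elim: n => [|n IH]; first by rewrite !expr0.
by rewrite !exprS; apply: le_trans (NM _ _) _; rewrite ler_wpM2l.
Qed.

Let N_sum n (f : nat -> A) : N (\sum_(i < n) f i) <= \sum_(i < n) N (f i).
Proof.
elim: n => [|n IH]; first by rewrite !big_ord0 N0.
by rewrite !big_ord_recr; apply: le_trans (ND _ _) _; rewrite lerD2r.
Qed.

Let ncvg_unique u l l' : ncvg u l -> ncvg u l' -> l = l'.
Proof.
move=> ul ul'; apply/eqP; rewrite -subr_eq0; apply/eqP/N_eq0.
have c0 : (fun=> N (l - l')) @ \oo --> (0 : R).
  apply: (@squeeze0 _ _ (fun n => N (u n - l) + N (u n - l'))).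
    move=> n; rewrite N_ge0 /= -(NN (u n - l)).
    by apply: le_trans (ND _ _); rewrite opprB addrA subrK.
  by rewrite -[X in _ --> X]addr0; exact: cvgD ul ul'.
apply/esym; apply: (cvg_unique _ c0); first exact: Rhausdorff.
exact: cvg_cst.
Qed.

Let ncvg_cst l : ncvg (fun=> l) l.
Proof. by rewrite /norm_cvg subrr N0; exact: cvg_cst. Qed.

Let ncvgD0 u v l : ncvg u l -> ncvg (fun n => v n - u n) 0 -> ncvg v l.
Proof.
move=> ul vu; apply: (@squeeze0 _ _ (fun n => N (v n - u n - 0) + N (u n - l))).
  move=> n; rewrite N_ge0 /= subr0.
  by apply: le_trans (ND _ _); rewrite addrA subrK.
by rewrite -[X in _ --> X]addr0; exact: cvgD vu ul.
Qed.

Let ncvgM u v l m : ncvg u l -> ncvg v m -> ncvg (fun n => u n * v n) (l * m).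
Proof.
move=> ul vm.
apply: (@squeeze0 _ _ (fun n => N (u n - l) * (N m + N (v n - m))
                                + N l * N (v n - m))).
  move=> n; rewrite N_ge0 /=.
  have -> : u n * v n - l * m = (u n - l) * v n + l * (v n - m) by ring.
  apply: le_trans (ND _ _) (lerD (le_trans (NM _ _) _) (NM _ _)).
  by rewrite ler_wpM2l // -{1}(subrK m (v n)) addrC ND.
have -> : (0 : R) = 0 * (N m + 0) + N l * 0 by rewrite mul0r mulr0 addr0.
by apply: cvgD; apply: cvgM => //; try apply: cvgD => //; exact: cvg_cst.
Qed.

Let N_lim_le u l K : ncvg u l -> (forall n, N (u n) <= K) -> N l <= K.
Proof.
move=> ul uK; rewrite -subr_le0.
have c : (fun=> N l - K) @ \oo --> (N l - K : R) by exact: cvg_cst.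
apply: (ler_cvg_to c ul); apply: nearW => n.
rewrite lerBlDr; have := ND (l - u n) (u n).
by rewrite subrK -opprB NN => /le_trans; apply; rewrite lerD2l.
Qed.

(** The inverse is the sum l of the geometric series, and l = 1 + x l gives N l <= 1 / (1 - N x).
    The bound is written as 1 plus a small term to suit [N_prod_le]. *)
Let inv1B x : N x < 1 ->
  1 - x \is a GRing.unit /\ N (1 - x)^-1 <= 1 + N x / (1 - N x).
Proof.
move=> x1; have x01 : 0 <= N x < 1 by rewrite N_ge0.
have x1' : 0 < 1 - N x by rewrite subr_gt0.
have [l ul] : exists l, ncvg (fun n => \sum_(i < n) x ^+ i) l.
  apply: (N_complete (K := 1) x01) => n.
  by rewrite big_ord_recr /= addrAC subrr add0r mul1r.
have l1 : (1 - x) * l = 1.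
  apply: (ncvg_unique (ncvgM (ncvg_cst (1 - x)) ul)).
  apply: (@squeeze0 _ _ (fun n => N x ^+ n)); last first.
    by apply: cvg_expr; rewrite ger0_norm.
  move=> n; rewrite N_ge0 /= -(opprB x 1) mulNr -subrX1 opprB addrAC subrr add0r.
  by rewrite NN.
have ux : 1 - x \is a GRing.unit by apply/unitrP; exists l; rewrite mulrC.
split=> //; have -> : (1 - x)^-1 = l by rewrite -[l](mulKr ux) l1 mulr1.
have ll : N l <= 1 + N x * N l.
  rewrite -{1}[l](subrK (x * l)) -{1}[l]mul1r -mulrBl l1.
  by apply: le_trans (ND _ _) _; apply: lerD.
have -> : 1 + N x / (1 - N x) = (1 - N x)^-1.
  by rewrite -{1}(divff (lt0r_neq0 x1')) -mulrDl subrK mul1r.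
by rewrite -[leRHS]mul1r ler_pdivlMr // mulrBr mulr1 lerBlDr mulrC.
Qed.

Variable q : A.
Hypothesis Nq : N q < 1.

Let r01 : 0 <= N q < 1. Proof. by rewrite N_ge0. Qed.

Let E K := expR (K / (1 - N q)).

Let N_prod_le K (f : nat -> A) n : 0 <= K ->
  (forall i, N (f i) <= 1 + K * N q ^+ i) -> N (\prod_(i < n) f i) <= E K.
Proof.
move=> K0 fK; apply: le_trans (prod_geometric_le n r01 K0).
elim: n => [|n IH]; first by rewrite !big_ord0.
by rewrite !big_ord_recr; apply: le_trans (NM _ _) _; apply: ler_pM.
Qed.

Let N_mulqX x i : N (x * q ^+ i) <= N x * N q ^+ i.
Proof. by apply: le_trans (NM _ _) _; rewrite ler_wpM2l. Qed.

Let N_qpoch_le K x n : N x <= K -> N (qpoch x q n) <= E K.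
Proof.
move=> xK; have K0 := le_trans (N_ge0 x) xK.
apply: (N_prod_le (f := fun i => 1 - x * q ^+ i)) => // i.
apply: le_trans (ND _ _) _; rewrite NN lerD //.
by apply: le_trans (N_mulqX _ _) _; rewrite ler_wpM2r // exprn_ge0.
Qed.

Let NqX_le i : N (q ^+ i.+1) <= N q.
Proof.
have /andP[r0 r1] := r01.
by apply: le_trans (NX _ _) _; rewrite exprS ler_piMr // exprn_ile1 // ltW.
Qed.

Let unitq n : 1 - q ^+ n.+1 \is a GRing.unit.
Proof. by have [] := inv1B (le_lt_trans (NqX_le n) Nq). Qed.

Let unit_qpoch n : qpoch q q n \is a GRing.unit.
Proof. by apply: rpred_prod => i _; rewrite -exprS. Qed.

(** By [inv1B], the inverse of 1 - q^(i+1) has norm at most 1 + K |q|^i with K = 1 / (1 - |q|). *)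
Let N_qpochV_le n : N (qpoch q q n)^-1 <= E (1 - N q)^-1.
Proof.
have /andP[r0 r1] := r01.
have r1' : 0 < 1 - N q by rewrite subr_gt0.
rewrite (_ : (qpoch q q n)^-1 = \prod_(i < n) (1 - q ^+ i.+1)^-1).
  apply: (N_prod_le (f := fun i => (1 - q ^+ i.+1)^-1)).
    by rewrite invr_ge0 ltW.
  move=> i; have qi := le_lt_trans (NqX_le i) Nq.
  apply: le_trans (inv1B qi).2 _; rewrite lerD2l mulrC ler_pM //.
  - by rewrite invr_ge0 subr_ge0 ltW.
  - by rewrite lef_pV2 ?posrE ?subr_gt0 // lerD2l lerN2.
  - by apply: le_trans (NX _ _) _; rewrite exprS ler_piMl ?exprn_ge0 // ltW.
elim: n => [|n IH]; first by rewrite /qpoch !big_ord0 invr1.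
by rewrite qpochS big_ord_recr -IH /= -exprS invrM // mulrC.
Qed.

(** The power of q splits as q^n times q^(0 + 1 + ... + (n-1)). The second part absorbs z^n,
    whatever the size of z, and q^n is left as the geometric factor. *)
Let N_gauss_le z n : N (z ^+ n * q ^+ 'C(n.+1, 2)) <= E (N z) * N q ^+ n.
Proof.
have -> : z ^+ n * q ^+ 'C(n.+1, 2) = q ^+ n * \prod_(i < n) (z * q ^+ i).
  elim: n => [|n IH]; first by rewrite big_ord0 !expr0 mul1r.
  rewrite big_ord_recr /= [in RHS]exprSr mulrACA -IH.
  by rewrite binS bin1 exprD !exprS; ring.
apply: le_trans (NM _ _) _; rewrite mulrC; apply: ler_pM => //.
apply: (N_prod_le (f := fun i => z * q ^+ i)) => // i.
by apply: le_trans (N_mulqX _ _) _; rewrite lerDr.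
Qed.

Let qpoch_cvg x : exists l, ncvg (qpoch x q) l.
Proof.
apply: (N_complete (K := E (N x) * N x) r01) => n.
rewrite qpochS mulrBr mulr1 addrAC subrr add0r NN.
by apply: le_trans (NM _ _) _; rewrite -mulrA; apply: ler_pM; rewrite ?N_qpoch_le.
Qed.

(* The n-th term of the series, with P x standing for (x; q)_oo. *)
Definition summand (P : A -> A) (a z : A) (n : nat) : A :=
  qpoch (z * a) q n * P (z * q ^+ n.+1) / qpoch q q n
    * z ^+ n * q ^+ ((n * n.+1)./2)%N.

Section Limit.
Variable P : A -> A.
Hypothesis qpochP : forall x, ncvg (qpoch x q) (P x).

(** The prefactor (q; q)_M compensates the denominator (q; q)_(M-n): for fixed n their quotient
    tends to 1. *)
Let fin_summand a z M n := qpoch q q M * (qpoch (z * a) q n / qpoch q q n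
    * (qpoch (z * q ^+ n.+1) q (M - n) / qpoch q q (M - n))
    * z ^+ n * q ^+ 'C(n.+1, 2)).

Let summandE a z n : summand P a z n =
  qpoch (z * a) q n * (qpoch q q n)^-1 * P (z * q ^+ n.+1)
  * (z ^+ n * q ^+ 'C(n.+1, 2)).
Proof. by rewrite /summand bin2 /= mulnC; ring. Qed.

Let bound a z : R := E (N q) * (E (N (z * a)) * E (1 - N q)^-1
  * (E (N z) * E (1 - N q)^-1)) * E (N z).

Let fin_summand_le a z M n : N (fin_summand a z M n) <= bound a z * N q ^+ n.
Proof.
rewrite /fin_summand /bound -(mulrA _ (z ^+ n)).
rewrite -[leRHS]mulrA -[leRHS]mulrA.
apply: le_trans (NM _ _) _; apply: ler_pM => //; first exact: N_qpoch_le.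
apply: le_trans (NM _ _) _; apply: ler_pM => //.
apply: le_trans (NM _ _) _; apply: ler_pM => //.
  by apply: le_trans (NM _ _) _; apply: ler_pM => //; exact: N_qpoch_le.
apply: le_trans (NM _ _) _; apply: ler_pM => //.
apply: N_qpoch_le; apply: le_trans (N_mulqX _ _) _.
by rewrite ler_piMr // exprn_ile1 // ?ltW //; case/andP: r01.
Qed.

Let fin_summand_cvg a z n :
  ncvg (fun M => fin_summand a z M n) (summand P a z n).
Proof.
(* Replacing M by M + n removes the truncated subtraction [M - n]. *)
rewrite /norm_cvg -(cvg_shiftn n) -/(norm_cvg N (fun M => fin_summand a z (M + n) n) _).
(* The quotient is the product of the n factors 1 - q^(M+i), 1 <= i <= n, each of which tends to
   1. *)
have c1 : ncvg (fun M => qpoch q q (M + n) / qpoch q q M) 1.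
  elim: n => [|n IH].
    rewrite (_ : (fun M => _) = fun=> 1); first exact: ncvg_cst.
    by apply/funext => M; rewrite addn0 divrr.
  have c2 : ncvg (fun M => 1 - q ^+ (M + n).+1) 1.
    apply: (@squeeze0 _ _ (fun M => N q ^+ M)); last first.
      by apply: cvg_expr; rewrite ger0_norm.
    move=> M; rewrite N_ge0 /= addrAC subrr add0r NN -addnS exprD.
    have /andP[r0 r1] := r01.
    apply: le_trans (NM _ _) _; rewrite -[leRHS]mulr1; apply: ler_pM => //.
    by apply: le_trans (NqX_le n) (ltW r1).
  have := ncvgM IH c2; rewrite mulr1.
  rewrite (_ : (fun M => _ * _) = fun M => qpoch q q (M + n.+1) / qpoch q q M) //.
  by apply/funext => M; rewrite addnS qpochS -exprS mulrAC.
have := ncvgM c1 (ncvgM (qpochP (z * q ^+ n.+1)) (ncvg_cst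
  (qpoch (z * a) q n * (qpoch q q n)^-1 * (z ^+ n * q ^+ 'C(n.+1, 2))))).
rewrite (_ : 1 * _ = summand P a z n); last by rewrite summandE; ring.
rewrite (_ : (fun M => _ * (_ * _)) = fun M => fin_summand a z (M + n) n) //.
by apply/funext => M; rewrite /fin_summand addnK; ring.
Qed.

Let summand_le a z n : N (summand P a z n) <= bound a z * N q ^+ n.
Proof. exact: N_lim_le (fin_summand_cvg a z n) (fin_summand_le a z ^~ n). Qed.

Let series_summand_cvg a z l :
  ncvg (series (summand P a z)) l ->
  ncvg (fun M => qpoch q q M * finite_sum q a z M) l.
Proof.
move=> sl.
(* [series] at M stops before the term of index M, while [finite_sum] includes it. *)
have sl' : ncvg (fun M => series (summand P a z) M.+1) l.
  by move: sl; rewrite /norm_cvg -(cvg_shiftS (fun n => N (_ n - l))).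
apply: ncvgD0 sl' _.
apply: (@squeeze0 _ _ (fun M => \sum_(n < M.+1)
    N (fin_summand a z M n - summand P a z n))).
  move=> M; rewrite N_ge0 /= subr0 /series /= big_mkord.
  rewrite mulr_sumr -sumrB.
  exact: (N_sum _ (fun n => fin_summand a z M n - summand P a z n)).
(* [bound] counts twice: once for the truncated term and once for its limit. *)
apply: (tannery0 (h := fun M n => N (fin_summand a z M n - summand P a z n))
  (K := bound a z + bound a z) r01) => [M n _|n].
  rewrite N_ge0 mulrDl; apply: le_trans (ND _ _) _.
  by rewrite NN lerD // ?fin_summand_le // summand_le.
exact: fin_summand_cvg.
Qed.

(** By [finite_sumN], both series have the limit of one and the same sequence of finite sums. *)
Lemma series_summandN a z : exists l,
  ncvg (series (summand P a z)) l /\ ncvg (series (summand P a (- z))) l.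
Proof.
have ex y : exists l, ncvg (series (summand P a y)) l.
  apply: (N_complete (K := bound a y) r01) => n.
  by rewrite seriesSB summand_le.
have [l zl] := ex z; have [l' zl'] := ex (- z).
exists l; split=> //; rewrite (_ : l = l') //.
apply: ncvg_unique (series_summand_cvg zl) _.
rewrite (_ : (fun M => _) = fun M => qpoch q q M * finite_sum q a (- z) M).
  exact: series_summand_cvg.
by apply/funext => M; rewrite finite_sumN.
Qed.

End Limit.

(** The function [P] stands for (x; q)_oo, since [limn] has no meaning on the bare ring [A]; the
    instances identify [P x] with the topological limit. *)
Theorem summand_symmetry : exists P : A -> A,
  (forall x, ncvg (qpoch x q) (P x)) /\
  forall a z, exists l,
    ncvg (series (summand P a z)) l /\ ncvg (series (summand P a (- z))) l.
Proof.
have [P qpochP] := choice qpoch_cvg.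
by exists P; split=> // a z; exact: series_summandN.
Qed.

End CompleteNormedRing.

(** * Complex numbers with the real-valued modulus *)

Section ComplexInstance.
Variable R : realType.
Implicit Types (x y l : R[i]) (u : nat -> R[i]).
Local Notation normc := (@Normc.normc R).

Lemma normc_le x : normc x <= `|complex.Re x| + `|complex.Im x|.
Proof.
case: x => a b /=; rewrite -(@ler_pXn2r _ 2) ?nnegrE ?sqrtr_ge0 ?addr_ge0 //.
rewrite sqr_sqrtr ?addr_ge0 ?sqr_ge0 // sqrrD !real_normK ?num_real //.
by rewrite addrAC lerDl mulrn_wge0 // mulr_ge0.
Qed.

Lemma Re_le_normc x : `|complex.Re x| <= normc x.
Proof.
by case: x => a b /=; rewrite -sqrtr_sqr ler_wsqrtr // lerDl sqr_ge0.
Qed.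

Lemma Im_le_normc x : `|complex.Im x| <= normc x.
Proof.
by case: x => a b /=; rewrite -sqrtr_sqr ler_wsqrtr // lerDr sqr_ge0.
Qed.

Lemma normc_complete u (r K : R) : 0 <= r < 1 ->
  (forall n, normc (u n.+1 - u n) <= K * r ^+ n) ->
  exists l, norm_cvg normc u l.
Proof.
move=> r01 uK.
have cRe : cvgn (fun n => complex.Re (u n)).
  apply: (cvg_geometric_increments r01) => n; apply: le_trans (uK n).
  by apply: le_trans (Re_le_normc _); case: (u n.+1) (u n) => [a b] [c d].
have cIm : cvgn (fun n => complex.Im (u n)).
  apply: (cvg_geometric_increments r01) => n; apply: le_trans (uK n).
  by apply: le_trans (Im_le_normc _); case: (u n.+1) (u n) => [a b] [c d].
pose a := limn (fun n => complex.Re (u n)).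
pose b := limn (fun n => complex.Im (u n)).
exists (a +i* b).
apply: (@squeeze0 _ _ (fun n => `|complex.Re (u n) - a| + `|complex.Im (u n) - b|)).
  move=> n; apply/andP; split; last by apply: le_trans (normc_le _) _; case: (u n).
  exact: le_trans (Re_le_normc _).
have -> : (0 : R) = `|a - a| + `|b - b| by rewrite !subrr normr0 addr0.
by apply: cvgD; apply: cvg_norm; apply: cvgB => //; exact: cvg_cst.
Qed.

Lemma normc_cvg u l : norm_cvg normc u l -> u @ \oo --> l.
Proof.
move=> ul; apply/cvgrPdist_lt => -[e e'] e0.
(* In the order of [R[i]], a positive radius has zero imaginary part. *)
have [e'0 {}e0] : e' = 0 /\ 0 < e by move: e0; rewrite ltcE /= => /andP[/eqP].
rewrite {e'}e'0; move/cvgr0Pnorm_lt: ul => /(_ _ e0); apply: filterS => n.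
move=> nlt; rewrite distrC ltcE /= eqxx /=; exact: le_lt_trans (ler_norm _) nlt.
Qed.

End ComplexInstance.

(** * Formal power series with the X-adic norm *)

Section FpsInstance.
Variable R : comNzRingType.
Implicit Types (f g l : fps R) (u : nat -> fps R).
(* Any realType would do for the values of the norm. *)
Local Notation RR := Rdefinitions.R.

Lemma fps_neq0_ex f : f != 0 -> exists n, fcoef f n != 0.
Proof.
move=> f0; apply: contrapT => nex; move/eqP: f0; apply; apply: fpsP => n.
rewrite [RHS](_ : _ = 0); last by case: n.
by apply/eqP/negP => /negP fn; apply: nex; exists n.
Qed.

(* 2 ^- ord f, with value 0 at 0. *)
Definition fps_norm f : RR :=
  if pselect (exists n, fcoef f n != 0) is left ex then 2 ^- ex_minn ex else 0.

(** Turns norm estimates into the vanishing of initial coefficients, the form in which sums and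
    products are checked. *)
Lemma fps_normP f n : reflect (forall k, (k < n)%N -> fcoef f k = 0)
  (fps_norm f <= 2 ^- n).
Proof.
apply: (iffP idP); rewrite /fps_norm.
  case: pselect => [ex|nex _ k _]; last first.
    by apply/eqP/negP => /negP fk; apply: nex; exists k.
  case: ex_minnP => m fm mmin.
  rewrite lef_pV2 ?posrE ?exprn_gt0 // ler_eXn2l ?ltr1n // => nm k kn.
  apply/eqP/negP => /negP/mmin mk.
  by have := leq_ltn_trans (leq_trans nm mk) kn; rewrite ltnn.
move=> f0; case: pselect => [ex|_]; last by rewrite invr_ge0 exprn_ge0.
case: ex_minnP => m fm _; rewrite lef_pV2 ?posrE ?exprn_gt0 // ler_eXn2l ?ltr1n //.
by rewrite leqNgt; apply/negP => /f0 fm0; rewrite fm0 eqxx in fm.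
Qed.

Lemma fps_norm0 : fps_norm 0 = 0.
Proof.
rewrite /fps_norm; case: pselect => // ex; exfalso.
by case: ex => -[|n]; rewrite eqxx.
Qed.

Lemma fps_norm_val f : fps_norm f = 0 /\ f = 0 \/ exists n, fps_norm f = 2 ^- n.
Proof.
have [->|f0] := eqVneq f 0.
  by left; rewrite fps_norm0.
right; rewrite /fps_norm; case: pselect => [ex|]; first by exists (ex_minn ex).
by move/(_ (fps_neq0_ex f0)).
Qed.

Lemma fps_norm_eq0 f : fps_norm f = 0 -> f = 0.
Proof.
case: (fps_norm_val f) => [[]//|[n ->]] /eqP.
by rewrite invr_eq0 expf_eq0 pnatr_eq0 andbF.
Qed.

Lemma fps_norm_ge0 f : 0 <= fps_norm f.
Proof.
by case: (fps_norm_val f) => [[->]//|[n ->]]; rewrite invr_ge0 exprn_ge0.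
Qed.

Lemma fps_norm_le1 f : fps_norm f <= 1.
Proof. by rewrite -[1]invr1 -(expr0 2); apply/fps_normP. Qed.

Lemma fps_normN f : fps_norm (- f) = fps_norm f.
Proof.
have le g : fps_norm (- g) <= fps_norm g.
  case: (fps_norm_val g) => [[-> ->]|[n gn]]; first by rewrite oppr0 fps_norm0.
  rewrite gn; apply/fps_normP => k kn /=.
  suff -> : fcoef g k = 0 by rewrite oppr0.
  by have /fps_normP -> : fps_norm g <= 2 ^- n by rewrite gn.
by apply: le_anti; rewrite le /= -{1}(opprK f) le.
Qed.

(** The proof gives the ultrametric bound by the larger norm. *)
Lemma fps_normD f g : fps_norm (f + g) <= fps_norm f + fps_norm g.
Proof.
wlog fg : f g / fps_norm f <= fps_norm g.
  move=> wl; case/orP: (le_total (fps_norm f) (fps_norm g)) => /wl //.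
  by rewrite addrC [leRHS]addrC.
apply: (@le_trans _ _ (fps_norm g)); last by rewrite lerDr fps_norm_ge0.
case: (fps_norm_val g) => [[g0 ->]|[n gn]]; first by rewrite addr0 fps_norm0 -g0.
rewrite gn; apply/fps_normP => k kn /=.
have /fps_normP/(_ k kn) -> : fps_norm f <= 2 ^- n by rewrite -gn.
have /fps_normP/(_ k kn) -> : fps_norm g <= 2 ^- n by rewrite gn.
by rewrite addr0.
Qed.

Lemma fps_normM f g : fps_norm (f * g) <= fps_norm f * fps_norm g.
Proof.
case: (fps_norm_val f) => [[-> ->]|[m fm]]; first by rewrite !mul0r fps_norm0.
case: (fps_norm_val g) => [[-> ->]|[n gn]]; first by rewrite !mulr0 fps_norm0.
rewrite fm gn -invfM -exprD; apply/fps_normP => k kmn /=.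
(* For k < m + n, either i < m or k - i < n, so one of the two factors vanishes. *)
apply: big1 => i _; have [im|mi] := ltnP i m.
  have /fps_normP -> // : fps_norm f <= 2 ^- m by rewrite fm.
  by rewrite mul0r.
have /fps_normP -> : fps_norm g <= 2 ^- n by rewrite gn.
  by rewrite mulr0.
have := ltn_ord i; rewrite ltnS => ik.
by rewrite ltn_subLR // (leq_trans kmn) // leq_add2r.
Qed.

Lemma fps_norm_cvg u l : norm_cvg fps_norm u l <-> u @ \oo --> l.
Proof.
split=> [ul|/fps_cvgP ul].
  apply/fps_cvgP => k; move/cvgr0Pnorm_lt: ul => /(_ (2 ^- k.+1)) [].
    by rewrite invr_gt0 exprn_gt0.
  move=> m _ um; exists m => // n /um /=; rewrite ger0_norm ?fps_norm_ge0 //.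
  by move/ltW/fps_normP/(_ k (ltnSn k))/eqP; rewrite /= subr_eq0 => /eqP.
apply/cvgr0Pnorm_lt => eps eps0.
have [m meps] : exists m, (2 : RR) ^- m < eps.
  have h : `|(2 : RR)^-1| < 1.
    by rewrite ger0_norm ?invr_ge0 // invf_lt1 // ltr1n.
  have /cvgr0Pnorm_lt/(_ _ eps0)[m _ /(_ m (leqnn _)) /=] := cvg_expr h.
  by move=> /(le_lt_trans (ler_norm _)); rewrite exprVn; exists m.
have : \forall n \near \oo, forall k, (k < m)%N -> fcoef (u n) k = fcoef l k.
  elim: m {meps} => [|m IH]; first exact: nearW.
  apply: filterS2 IH (ul m) => n un um k.
  by rewrite ltnS leq_eqVlt => /predU1P[->|/un].
apply: filterS => n un; rewrite ger0_norm ?fps_norm_ge0 //.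
apply: le_lt_trans meps; apply/fps_normP => k km /=.
by rewrite un // subrr.
Qed.

(** An increment of norm at most 2^-(k+1) does not change coefficient k, so each coefficient is
    eventually constant; the stable values form the limit. *)
Lemma fps_norm_complete u (r K : RR) : 0 <= r < 1 ->
  (forall n, fps_norm (u n.+1 - u n) <= K * r ^+ n) ->
  exists l, norm_cvg fps_norm u l.
Proof.
move=> /andP[r0 r1] uK.
have stab k : exists m, forall n, (m <= n)%N -> fcoef (u n) k = fcoef (u m) k.
  have h : `|r| < 1 by rewrite ger0_norm.
  have k0 : 0 < (2 : RR) ^- k.+1 by rewrite invr_gt0 exprn_gt0.
  have /cvgr0Pnorm_lt/(_ _ k0)[m _ rm] := @cvg_geometric _ K _ h.
  exists m => n /subnK <-; elim: (n - m)%N => // i <-.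
  rewrite addSn; apply/eqP; rewrite -subr_eq0; apply/eqP.
  have /fps_normP/(_ k (ltnSn k)) // :
    fps_norm (u (i + m).+1 - u (i + m)%N) <= 2 ^- k.+1.
  apply: le_trans (uK _) (le_trans (ler_norm _) (ltW (rm _ _))).
  exact: leq_addl.
have [m mP] := choice stab.
exists (Fps (fun k => fcoef (u (m k)) k)); apply/fps_norm_cvg/fps_cvgP => k.
by exists (m k) => // n /mP.
Qed.

(** X-adic limits are unique: for each k, some [u n] shares its k-th coefficient with both
    limits. *)
Lemma fps_lim u l : norm_cvg fps_norm u l -> limn u = l.
Proof.
move/fps_norm_cvg => ul; have /fps_cvgP ul' : u @ \oo --> limn u.
  by apply/cvg_ex; exists l.
move/fps_cvgP: ul => ul; apply: fpsP => k.
have [n [<- <-]] := filter_ex (filterI (ul' k) (ul k)).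
by [].
Qed.

End FpsInstance.

(* First conjunct: formal power series in q; second: complex q with |q| < 1. *)
Theorem theorem1p1 :
  (forall (R : comNzRingType) (a0 z0 : R),
     let a : fps R := fpsC a0 in
     let z : fps R := fpsC z0 in
     let q : fps R := fpsX R in
     let lhs (n : nat) : fps R :=
       qpoch (z * a) q n * qpoch_oo (z * q ^+ n.+1) q / qpoch q q n
         * z ^+ n * q ^+ ((n * n.+1)./2)%N in
     let rhs (n : nat) : fps R :=
       qpoch (- z * a) q n * qpoch_oo (- z * q ^+ n.+1) q / qpoch q q n
         * (- z) ^+ n * q ^+ ((n * n.+1)./2)%N in
     [/\ forall n : nat, cvgn (qpoch (z * q ^+ n.+1) q),
         forall n : nat, cvgn (qpoch (- z * q ^+ n.+1) q),
         cvgn (series lhs),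
         cvgn (series rhs) &
         limn (series lhs) = limn (series rhs)])
  /\
  (forall (R : realType) (a z q : R[i]), `|q| < 1 ->
     let lhs (n : nat) : R[i] :=
       qpoch (z * a) q n * qpoch_oo (z * q ^+ n.+1) q / qpoch q q n
         * z ^+ n * q ^+ ((n * n.+1)./2)%N in
     let rhs (n : nat) : R[i] :=
       qpoch (- z * a) q n * qpoch_oo (- z * q ^+ n.+1) q / qpoch q q n
         * (- z) ^+ n * q ^+ ((n * n.+1)./2)%N in
     [/\ forall n : nat, cvgn (qpoch (z * q ^+ n.+1) q),
         forall n : nat, cvgn (qpoch (- z * q ^+ n.+1) q),
         cvgn (series lhs),
         cvgn (series rhs) &
         limn (series lhs) = limn (series rhs)]).
Proof.
split=> [R a0 z0 a z q lhs rhs|R a z q q1 lhs rhs].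
  have q1 : fps_norm q < 1.
    (* The constant coefficient of X is zero, so its norm is at most 1/2. *)
    apply: (@le_lt_trans _ _ (2 ^- 1)); first by apply/fps_normP => -[].
    by rewrite expr1 invf_lt1 // ltr1n.
  have [P [qP sP]] := summand_symmetry (@fps_norm0 R) (fps_norm_le1 1)
    (@fps_norm_eq0 R) (@fps_normN R) (@fps_normD R) (@fps_normM R)
    (@fps_norm_complete R) q1.
  have [l [lP rP]] := sP a z.
  have lhsE : lhs = summand q P a z.
    by apply/funext => n; rewrite /lhs (fps_lim (qP _)).
  have rhsE : rhs = summand q P a (- z).
    by apply/funext => n; rewrite /rhs (fps_lim (qP _)).
  rewrite lhsE rhsE; split.
  - by move=> n; apply/cvg_ex; exists (P (z * q ^+ n.+1)); apply/fps_norm_cvg/qP.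
  - by move=> n; apply/cvg_ex; exists (P (- z * q ^+ n.+1)); apply/fps_norm_cvg/qP.
  - by apply/cvg_ex; exists l; apply/fps_norm_cvg/lP.
  - by apply/cvg_ex; exists l; apply/fps_norm_cvg/rP.
  - by rewrite (fps_lim lP) (fps_lim rP).
(* The norm of [R[i]] is complex-valued; comparing real parts gives the real inequality. *)
have q1' : Normc.normc q < 1 by move: q1; rewrite ltcE => /andP[].
have n1 : Normc.normc (1 : R[i]) <= 1 by rewrite Normc.normc1.
have nM (x y : R[i]) : Normc.normc (x * y) <= Normc.normc x * Normc.normc y.
  by rewrite Normc.normcM.
have [P [qP sP]] := summand_symmetry (Normc.normc0 R) n1 (@Normc.eq0_normc R)
  (@normcN R) (@le_normcD R) nM (@normc_complete R) q1'.
have hl (u : nat -> R[i]) l : norm_cvg (@Normc.normc R) u l -> limn u = l.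
  by move/normc_cvg => ul; apply: cvg_lim ul; exact: norm_hausdorff.
have [l [lP rP]] := sP a z.
have lhsE : lhs = summand q P a z.
  by apply/funext => n; rewrite /lhs (hl _ _ (qP _)).
have rhsE : rhs = summand q P a (- z).
  by apply/funext => n; rewrite /rhs (hl _ _ (qP _)).
rewrite lhsE rhsE; split.
- by move=> n; apply/cvg_ex; exists (P (z * q ^+ n.+1)); exact: normc_cvg (qP _).
- by move=> n; apply/cvg_ex; exists (P (- z * q ^+ n.+1)); exact: normc_cvg (qP _).
- by apply/cvg_ex; exists l; exact: normc_cvg lP.
- by apply/cvg_ex; exists l; exact: normc_cvg rP.
- by rewrite (hl _ _ lP) (hl _ _ rP).
Qed.
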